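(* A perfect cuboid exists if and only if there exist rational numbers $\alpha_1,\beta_1,\gamma_1\in\mathbb{Q}\setminus\{0,1,-1\}$ satisfying $$\Big(\frac{2\alpha_1}{1+\alpha_1^2}\Big)^2+\Big(\frac{2\gamma_1}{1+\gamma_1^2}\Big)^2=\Big(\frac{2\beta_1}{1+\beta_1^2}\Big)^2.$$
   Context: A perfect cuboid is a triple of positive rational numbers $a,b,c$ such that $a^2+b^2$, $b^2+c^2$, $a^2+c^2$ and $a^2+b^2+c^2$ are all squares of rational numbers. *)

(* Defs.v *)
From mathcomp Require Import all_boot all_order all_algebra.

Set Implicit Arguments.
Unset Strict Implicit.
Unset Printing Implicit Defensive.

Import Order.TTheory GRing.Theory Num.Theory.
Local Open Scope ring_scope.

Definition is_square (x : rat) : Prop := exists y : rat, x = y ^+ 2.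

Definition perfect_cuboid (a b c : rat) : Prop :=
  [/\ 0 < a, 0 < b & 0 < c] /\
  [/\ is_square (a ^+ 2 + b ^+ 2),
      is_square (b ^+ 2 + c ^+ 2),
      is_square (a ^+ 2 + c ^+ 2)
    & is_square (a ^+ 2 + b ^+ 2 + c ^+ 2)].

(* Main.v *)
(** The map [m |-> (2m/(1+m^2), (1-m^2)/(1+m^2))] parametrises the rational
    points of the unit circle off the axes by the [m] outside [{0, 1, -1}].
    The theorem therefore concerns rational points [(s, s')], [(t, t')],
    [(u, u')] of that kind with [s^2 + t^2 = u^2].  Scaling a cuboid to space
    diagonal [1] makes [s], [t], [u] two edges and their face diagonal, the
    third edge being [u'] and the other two face diagonals [s'] and [t']. *)

Require Import Defs.
From mathcomp Require Import all_boot all_order all_algebra.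
From mathcomp Require Import ring lra.

Import Order.TTheory GRing.Theory Num.Theory.
Local Open Scope ring_scope.

Lemma notin_0_1_N1 (F : realFieldType) (m : F) :
  (m \notin [:: 0; 1; -1]) = (m != 0) && (m ^+ 2 != 1).
Proof. by rewrite !inE !negb_or sqrf_eq1 negb_or. Qed.

Lemma add1_sqr_neq0 (F : realFieldType) (m : F) : 1 + m ^+ 2 != 0.
Proof. by rewrite gt_eqF // ltr_pwDl ?sqr_ge0. Qed.

(* [m = tan (theta / 2) = sin theta / (1 + cos theta)] *)
Lemma circle_param (F : realFieldType) (x y : F) :
  x != 0 -> y != 0 -> x ^+ 2 + y ^+ 2 = 1 ->
  exists2 m, m \notin [:: 0; 1; -1] & x = 2 * m / (1 + m ^+ 2).
Proof.
move=> x0 y0 xy1.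
have x2 : x ^+ 2 = (1 + y) * (1 - y) by lra.
have y1 : 1 + y != 0.
  by apply: contra_neq x0 => y1; apply/eqP; rewrite -sqrf_eq0 x2 y1 mul0r.
have m1 : 1 + (x / (1 + y)) ^+ 2 = 2 / (1 + y).
  by rewrite expr_div_n x2; field.
exists (x / (1 + y)); last by rewrite m1; field; rewrite y1 ?pnatr_eq0.
rewrite notin_0_1_N1 mulf_neq0 ?invr_eq0 //=.
(* If [m ^+ 2 = 1], then [m1] reads [1 + 1 = 2 / (1 + y)], which forces [y = 0]. *)
apply: contra_neq y0 => mE; move: m1; rewrite mE => /(congr1 ( *%R^~ (1 + y))).
by rewrite mulfVK //; lra.
Qed.

Lemma circle_point (F : realFieldType) (m : F) :
  m \notin [:: 0; 1; -1] ->
  2 * m / (1 + m ^+ 2) != 0 /\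
  exists2 y, y != 0 & (2 * m / (1 + m ^+ 2)) ^+ 2 + y ^+ 2 = 1.
Proof.
rewrite notin_0_1_N1 => /andP[m0 m1]; have d0 := add1_sqr_neq0 _ m.
split; first by rewrite !mulf_neq0 ?invr_eq0 ?pnatr_eq0.
exists ((1 - m ^+ 2) / (1 + m ^+ 2)); last by field.
by rewrite mulf_neq0 ?invr_eq0 // subr_eq0 eq_sym.
Qed.

Theorem theorem1 :
  (exists a b c : rat, perfect_cuboid a b c) <->
  (exists alpha1 beta1 gamma1 : rat,
    [/\ alpha1 \notin [:: 0; 1; -1],
        beta1 \notin [:: 0; 1; -1],
        gamma1 \notin [:: 0; 1; -1]
      & (2 * alpha1 / (1 + alpha1 ^+ 2)) ^+ 2
        + (2 * gamma1 / (1 + gamma1 ^+ 2)) ^+ 2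
        = (2 * beta1 / (1 + beta1 ^+ 2)) ^+ 2]).
Proof.
split=> [[a [b [c [[a0 b0 c0] [[r ab] [p bc] [q ac] [d abc]]]]]]|].
  have a2 : 0 < a ^+ 2 by rewrite exprn_gt0.
  have b2 : 0 < b ^+ 2 by rewrite exprn_gt0.
  have c2 : 0 < c ^+ 2 by rewrite exprn_gt0.
  have nz (z : rat) : 0 < z ^+ 2 -> z != 0 by move/lt0r_neq0; rewrite sqrf_eq0.
  (* The signs of these roots are unknown, but their squares are sums of positive squares. *)
  have [r0 p0 q0 d0] : [/\ r != 0, p != 0, q != 0 & d != 0].
    by split; apply: nz; lra.
  have param x y : x != 0 -> y != 0 -> x ^+ 2 + y ^+ 2 = d ^+ 2 ->
      exists2 m, m \notin [:: 0; 1; -1] & x / d = 2 * m / (1 + m ^+ 2).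
    move=> x0 y0 xyd; apply: (circle_param _ (x / d) (y / d)).
    - by rewrite mulf_neq0 ?invr_eq0.
    - by rewrite mulf_neq0 ?invr_eq0.
    - by rewrite !expr_div_n -mulrDl xyd divff ?sqrf_eq0.
  (* Each edge is orthogonal to a face whose diagonal completes it to [d]: [a] with [p], [b] with
     [q], [c] with [r]. *)
  have [|al al1 sE] := param a p (nz _ a2) p0; first by lra.
  have [|ga ga1 tE] := param b q (nz _ b2) q0; first by lra.
  have [|be be1 uE] := param r c r0 (nz _ c2); first by lra.
  exists al, be, ga; split=> //.
  by rewrite -sE -tE -uE !expr_div_n -mulrDl ab.
move=> [al [be [ga [/circle_point[s0 [s' _ ss]] /circle_point[_ [u' u0 uu]]]]]].
move=> /circle_point[t0 [t' _ tt]].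
move: s0 t0 ss tt uu; set s := _ / _; set t := 2 * ga / _; set u := 2 * be / _.
move=> s0 t0 ss tt uu stu.
(* Edges must be positive, while [s], [t], [u'] may be negative. *)
exists `|s|, `|t|, `|u'|; split; first by rewrite !normr_gt0.
rewrite !real_normK ?num_real //.
(* For instance, [stu] gives [t ^+ 2 + u' ^+ 2 = 1 - s ^+ 2 = s' ^+ 2]. *)
by split; [exists u | exists s' | exists t' | exists 1; rewrite expr1n]; lra.
Qed.
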